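(* Let $\Sigma$ be an $m$-dimensional Riemannian manifold of class $C^1$, let $Q\ge1$ be an integer, and let $E=\Sigma\times\mathbb{R}^n$ be the trivial bundle of rank $n$ over $\Sigma$. Then a $Q$-multisection $M\colon E\to\mathbb{N}$ over $\Sigma$ is coherent if and only if the associated multiple valued function $u_M\colon\Sigma\to\mathcal{A}_Q(\mathbb{R}^n)$, $$u_M(p)=\sum_{v\in\mathbb{R}^n}M(p,v)\,\llbracket v\rrbracket,$$ is continuous.
   Context: $\mathbb{N}$ includes $0$. $\mathcal{A}_Q(\mathbb{R}^n)=\{\sum_{l=1}^Q\llbracket v_l\rrbracket : v_l\in\mathbb{R}^n\}$, where $\llbracket v\rrbracket$ is the Dirac delta at $v$, with the metric $\mathcal{G}(\sum_l\llbracket v_l\rrbracket,\sum_l\llbracket w_l\rrbracket)=\big(\min_\sigma\sum_l|v_l-w_{\sigma(l)}|^2\big)^{1/2}$ over permutations $\sigma$ of $\{1,\dots,Q\}$. Given a vector bundle $\Pi\colon E\to\Sigma$ with fibers $E_p=\Pi^{-1}(\{p\})$, a *$Q$-multisection* over $\Sigma$ is a map $M\colon E\to\mathbb{N}$ with $\sum_{\xi\in E_p}M(\xi)=Q$ for every $p\in\Sigma$. Put $M_p:=\{\xi\in E_p : M(\xi)>0\}$. $M$ is *coherent* if for every $p\in\Sigma$ and every disjoint family $\mathcal{V}$ of open sets $V\subset E$ such that each $V\in\mathcal{V}$ contains exactly one element of $M_p$, there is an open neighborhood $U$ of $p$ in $\Sigma$ such that for every $q\in U$ and every $V\in\mathcal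 V$ $$\sum_{\zeta\in M_q\cap V}M(\zeta)=M(\xi)\qquad\text{if }\xi\in M_p\cap V.$$
   Formalization: In the definition of coherent, the disjoint family of open sets is also required to cover M_p; without this the claim fails, e.g. for the continuous u(q)=[[0]]+[[1-|q|]] on the line with p=0 and the single open set {v<1}. *)

(* Defs.v *)
From HB Require Import structures.
From mathcomp Require Import all_boot all_order all_algebra all_fingroup finmap.
From mathcomp Require Import all_classical all_reals all_analysis.

Set Implicit Arguments.
Unset Strict Implicit.
Unset Printing Implicit Defensive.
Import Order.TTheory GRing.Theory Num.Theory.
Import numFieldNormedType.Exports.
Local Open Scope classical_set_scope.
Local Open Scope ring_scope.

Record chart (R : realType) (m : nat) (S : topologicalType) := Chart {
  chart_dom : set S ;
  chart_map : S -> 'rV[R]_m ;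
  chart_inv : 'rV[R]_m -> S ;
  chart_dom_open : open chart_dom ;
  chart_img_open : open (chart_map @` chart_dom) ;
  chart_mapK : {in chart_dom, cancel chart_map chart_inv} ;
  chart_map_continuous : {within chart_dom, continuous chart_map} ;
  chart_inv_continuous :
    {within chart_map @` chart_dom, continuous chart_inv} }.

Section transition.
Context (R : realType) (m : nat) (S : topologicalType).
Implicit Types phi psi : chart R m S.

Definition transition phi psi : 'rV[R]_m -> 'rV[R]_m :=
  chart_map psi \o chart_inv phi.

Definition overlap phi psi : set 'rV[R]_m :=
  chart_map phi @` (chart_dom phi `&` chart_dom psi).

End transition.

Definition C1_on (R : realType) (m k : nat) (A : set 'rV[R]_m)
    (f : 'rV[R]_m -> 'rV[R]_k) :=
  forall x, A x ->
    differentiable f x /\ {for x, continuous (fun y => jacobian f y)}.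

(* A manifold of class C^1 carries a continuous metric; [metric phi] is its
   matrix in the coordinates of phi.  Vectors are rows ([v *m jacobian f x] is
   the derivative of f at x along v), which fixes the side on which the
   transpose sits in [metric_change]. *)
Record riemannianC1 (R : realType) (m : nat) := RiemannianC1 {
  carrier :> topologicalType ;
  carrier_hausdorff : hausdorff_space carrier ;
  carrier_second_countable : @second_countable carrier ;
  atlas : set (chart R m carrier) ;
  atlas_cover : \bigcup_(phi in atlas) chart_dom phi = [set: carrier] ;
  atlas_C1 : forall phi psi, atlas phi -> atlas psi ->
    C1_on (overlap phi psi) (transition phi psi) ;
  metric : chart R m carrier -> 'rV[R]_m -> 'M[R]_m ;
  metric_continuous : forall phi, atlas phi ->
    {within chart_map phi @` chart_dom phi, continuous (metric phi)} ;
  metric_sym : forall phi x, atlas phi -> (chart_map phi @` chart_dom phi) x ->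
    (metric phi x)^T = metric phi x ;
  metric_pos : forall phi x, atlas phi -> (chart_map phi @` chart_dom phi) x ->
    forall v : 'rV[R]_m, v != 0 -> 0 < (v *m metric phi x *m v^T) 0 0 ;
  metric_change : forall phi psi x, atlas phi -> atlas psi ->
    overlap phi psi x ->
    metric phi x =
      jacobian (transition phi psi) x *m metric psi (transition phi psi x)
        *m (jacobian (transition phi psi) x)^T }.

Section euclidean.
Context (R : realType).

Definition l2norm (I : finType) (f : I -> R) : R :=
  Num.sqrt (\sum_i f i ^+ 2).

Lemma sumsq_ge0 (I : finType) (f : I -> R) : 0 <= \sum_i f i ^+ 2.
Proof. by apply: sumr_ge0 => i _; exact: sqr_ge0. Qed.

Lemma cauchy_schwarz_sum (I : finType) (f g : I -> R) :
  (\sum_i f i * g i) ^+ 2 <= (\sum_i f i ^+ 2) * (\sum_i g i ^+ 2).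
Proof.
have h : 0 <= \sum_i \sum_j (f i * g j - f j * g i) ^+ 2.
  by apply: sumr_ge0 => i _; apply: sumr_ge0 => j _; exact: sqr_ge0.
have e1 : (\sum_i f i ^+ 2) * (\sum_i g i ^+ 2) =
    \sum_i \sum_j f i ^+ 2 * g j ^+ 2.
  by rewrite mulr_suml; apply: eq_bigr => i _; rewrite mulr_sumr.
have e2 : (\sum_i f i * g i) ^+ 2 =
    \sum_i \sum_j (f i * g j) * (f j * g i).
  rewrite expr2 mulr_suml; apply: eq_bigr => i _; rewrite mulr_sumr.
  by apply: eq_bigr => j _; rewrite mulrACA [RHS]mulrACA [g j * g i]mulrC.
have e3 : (\sum_i f i ^+ 2) * (\sum_i g i ^+ 2) =
    \sum_i \sum_j f j ^+ 2 * g i ^+ 2.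
  by rewrite e1 exchange_big.
have : \sum_i \sum_j (f i * g j - f j * g i) ^+ 2 =
   ((\sum_i f i ^+ 2) * (\sum_i g i ^+ 2) - (\sum_i f i * g i) ^+ 2) *+ 2.
  rewrite mulrnBl {1}mulr2n {1}e1 e3 e2 -big_split -sumrMnl -sumrB.
  apply: eq_bigr => i _ /=; rewrite -big_split -sumrMnl -sumrB.
  by apply: eq_bigr => j _ /=; rewrite sqrrB !exprMn addrAC.
by move=> e; move: h; rewrite e pmulrn_lge0// subr_ge0.
Qed.

Lemma l2norm_ge0 (I : finType) (f : I -> R) : 0 <= l2norm f.
Proof. exact: sqrtr_ge0. Qed.

Lemma l2norm_sqr (I : finType) (f : I -> R) :
  l2norm f ^+ 2 = \sum_i f i ^+ 2.
Proof. by rewrite sqr_sqrtr// sumsq_ge0. Qed.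

Lemma l2normD (I : finType) (f g : I -> R) :
  l2norm (fun i => f i + g i) <= l2norm f + l2norm g.
Proof.
rewrite -ler_sqr ?nnegrE ?addr_ge0 ?l2norm_ge0//.
rewrite sqrrD !l2norm_sqr.
have -> : \sum_i (f i + g i) ^+ 2 =
    \sum_i f i ^+ 2 + (\sum_i f i * g i) *+ 2 + \sum_i g i ^+ 2.
  by rewrite -sumrMnl -!big_split; apply: eq_bigr => i _; rewrite sqrrD.
rewrite lerD2r lerD2l lerMn2r/=.
apply: (le_trans (ler_norm _)).
rewrite -ler_sqr ?nnegrE ?mulr_ge0 ?l2norm_ge0//.
by rewrite real_normK ?num_real// exprMn !l2norm_sqr cauchy_schwarz_sum.
Qed.

(* the library norm on 'rV[R]_n is the sup norm *)
Definition enorm (n : nat) (x : 'rV[R]_n) : R := l2norm (x 0).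

End euclidean.

Section Qpoints.
Context (R : realType) (Q n : nat).
Local Notation V := 'rV[R]_n.
Local Notation borelV := (g_sigma_algebraType (@open V)).
Implicit Types v w : 'I_Q -> V.

Definition diracV (x : V) : set V -> \bar R := @dirac _ borelV x R.

Definition sum_dirac v : set V -> \bar R :=
  fun A => (\sum_(l < Q) diracV (v l) A)%E.

Record AQ := MkAQ {
  AQ_val :> set V -> \bar R ;
  AQ_ex : exists v, AQ_val = sum_dirac v }.

Definition AQ_of v : AQ := MkAQ (ex_intro _ v erefl).

Definition AQ_repr (S : AQ) : 'I_Q -> V := projT1 (cid (AQ_ex S)).

Lemma AQ_reprE S : AQ_val S = sum_dirac (AQ_repr S).
Proof. by rewrite /AQ_repr; case: cid. Qed.

Lemma AQ_inj S T : AQ_val S = AQ_val T -> S = T.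
Proof.
case: S T => [s hs] [t ht] /= st; subst t; congr MkAQ; exact: Prop_irrelevance.
Qed.

Definition Gcost v w (s : 'S_Q) : R := \sum_(l < Q) enorm (v l - w (s l)) ^+ 2.

(* the default value is the cost of the identity, so this is the minimum over
   all permutations *)
Definition Gtuple v w : R :=
  Num.sqrt (\big[Num.min/Gcost v w 1%g]_(s : 'S_Q) Gcost v w s).

Definition Gdist (S T : AQ) : R := Gtuple (AQ_repr S) (AQ_repr T).

Lemma Gcost_ge0 v w s : 0 <= Gcost v w s.
Proof. by apply: sumr_ge0 => l _; exact: sqr_ge0. Qed.

Lemma Gtuple_le v w s : Gtuple v w <= Num.sqrt (Gcost v w s).
Proof. by apply: ler_wsqrtr; exact: bigmin_le. Qed.

Lemma Gtuple_ex v w : exists s, Gtuple v w = Num.sqrt (Gcost v w s).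
Proof.
have : (\big[Num.min/Gcost v w 1%g]_(s : 'S_Q) Gcost v w s <=
        \big[Num.min/Gcost v w 1%g]_(s : 'S_Q) Gcost v w s) by [].
have h s : Gtuple v w <= Num.sqrt (Gcost v w s) by exact: Gtuple_le.
case/bigmin_leP => [le|[s _ le]]; [exists 1%g|exists s];
  by apply/le_anti; rewrite h/= ler_wsqrtr.
Qed.

Lemma sum_dirac1 v x :
  sum_dirac v [set x] = (#|[pred l | v l == x]|%:R)%:E.
Proof.
rewrite /sum_dirac /diracV /dirac sumEFin; congr (_%:E).
rewrite -sum1_card natr_sum [RHS]big_mkcond/=; apply: eq_bigr => l _.
rewrite indicE inE; case: eqVneq => [->|ne]; first by rewrite mem_set.
by rewrite memNset//= => e; move: ne; rewrite e eqxx.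
Qed.

Lemma sum_dirac_perm v w (s : 'S_Q) :
  (forall l, v l = w (s l)) -> sum_dirac v = sum_dirac w.
Proof.
move=> vw; apply/funext => A; rewrite /sum_dirac.
by rewrite [RHS](reindex_inj (@perm_inj _ s)); apply: eq_bigr => l _; rewrite vw.
Qed.

Lemma sum_dirac_inj v w : sum_dirac v = sum_dirac w ->
  exists s : 'S_Q, forall l, v l = w (s l).
Proof.
move=> vw.
have cnt x : #|[pred l | v l == x]| = #|[pred l | w l == x]|.
  have := congr1 (fun f => f [set x]) vw; rewrite !sum_dirac1 => -[/eqP].
  by rewrite eqr_nat => /eqP.
have : perm_eq [tuple v i | i < Q] [tuple w i | i < Q].
  apply/allP => x _ /=; apply/eqP.
  have c u : count_mem x [tuple u i | i < Q] = #|[pred l | u l == x]|.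
    by rewrite /= count_map -sum1_count -sum1_card big_enum_cond; apply: eq_bigl.
  by rewrite !c cnt.
case/tuple_permP => s e; exists s => l.
have : [tuple v i | i < Q] = [tuple tnth [tuple w i | i < Q] (s i) | i < Q].
  exact/val_inj.
by move=> /(congr1 (fun t => tnth t l)); rewrite !tnth_mktuple.
Qed.

Lemma Gcost_sqrt v w s : Num.sqrt (Gcost v w s) =
  l2norm (fun p : 'I_Q * 'I_n => (v p.1 - w (s p.1)) 0 p.2).
Proof.
congr Num.sqrt; rewrite -(pair_bigA _ (fun l i => (v l - w (s l)) 0 i ^+ 2))/=.
by apply: eq_bigr => l _; rewrite /enorm l2norm_sqr.
Qed.

Lemma Gtuple_permr v w w' (s : 'S_Q) :
  (forall l, w l = w' (s l)) -> Gtuple v w' <= Gtuple v w.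
Proof.
move=> ww; have [t ->] := Gtuple_ex v w.
apply: (le_trans (Gtuple_le v w' (t * s)%g)); rewrite le_eqVlt; apply/orP; left.
by apply/eqP; congr Num.sqrt; apply: eq_bigr => l _; rewrite permM ww.
Qed.

Lemma Gtuple_sym_le v w : Gtuple w v <= Gtuple v w.
Proof.
have [t ->] := Gtuple_ex v w.
apply: (le_trans (Gtuple_le w v t^-1%g)); rewrite le_eqVlt; apply/orP; left.
apply/eqP; congr Num.sqrt; rewrite /Gcost (reindex_inj (@perm_inj _ t)).
apply: eq_bigr => l _; rewrite permK /enorm /l2norm; congr (Num.sqrt _ ^+ 2).
by apply: eq_bigr => i _; rewrite !mxE -sqrrN opprB.
Qed.

Lemma Gtuple_sym v w : Gtuple v w = Gtuple w v.
Proof. by apply/le_anti; rewrite !Gtuple_sym_le. Qed.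

Lemma Gtuple_triangle w v u : Gtuple v u <= Gtuple v w + Gtuple w u.
Proof.
have [s ->] := Gtuple_ex v w; have [t ->] := Gtuple_ex w u.
apply: (le_trans (Gtuple_le v u (s * t)%g)); rewrite !Gcost_sqrt.
have -> : l2norm (fun p : 'I_Q * 'I_n => (w p.1 - u (t p.1)) 0 p.2) =
    l2norm (fun p : 'I_Q * 'I_n => (w (s p.1) - u (t (s p.1))) 0 p.2).
  rewrite -!Gcost_sqrt !Gcost_sqrt; congr Num.sqrt.
  rewrite -(pair_bigA _ (fun l i => (w l - u (t l)) 0 i ^+ 2))/=.
  rewrite -(pair_bigA _ (fun l i => (w (s l) - u (t (s l))) 0 i ^+ 2))/=.
  by rewrite (reindex_inj (@perm_inj _ s)).
apply: (le_trans _ (l2normD _ _)); rewrite le_eqVlt; apply/orP; left; apply/eqP.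
congr Num.sqrt; apply: eq_bigr => -[l i] _ /=; congr (_ ^+ 2).
by rewrite permM !mxE addrA subrK.
Qed.

Lemma Gdist_of v w : Gdist (AQ_of v) (AQ_of w) = Gtuple v w.
Proof.
rewrite /Gdist.
have [s sP] := sum_dirac_inj (AQ_reprE (AQ_of v)).
have [s' sP'] := sum_dirac_inj (esym (AQ_reprE (AQ_of v))).
have [t tP] := sum_dirac_inj (AQ_reprE (AQ_of w)).
have [t' tP'] := sum_dirac_inj (esym (AQ_reprE (AQ_of w))).
apply/le_anti/andP; split.
  rewrite (le_trans (Gtuple_permr _ tP))// Gtuple_sym [leRHS]Gtuple_sym.
  exact: Gtuple_permr sP.
rewrite (le_trans (Gtuple_permr _ tP'))// Gtuple_sym [leRHS]Gtuple_sym.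
exact: Gtuple_permr sP'.
Qed.

Lemma Gtuple0 v w : Gtuple v w = 0 <-> exists s : 'S_Q, forall l, v l = w (s l).
Proof.
split=> [|[s vw]].
  have [s ->] := Gtuple_ex v w; rewrite Gcost_sqrt => h; exists s => l.
  have := l2norm_sqr (fun p : 'I_Q * 'I_n => (v p.1 - w (s p.1)) 0 p.2).
  rewrite h expr0n/= => /esym/eqP.
  rewrite psumr_eq0 => [/allP e|p _]; last exact: sqr_ge0.
  apply/rowP => i; have := e (l, i); rewrite mem_index_enum => /(_ isT)/=.
  by rewrite sqrf_eq0 !mxE subr_eq0 => /eqP.
apply/le_anti; rewrite sqrtr_ge0 andbT (le_trans (Gtuple_le _ _ s))//.
rewrite /Gcost big1 ?sqrtr0// => l _.
by rewrite vw subrr /enorm l2norm_sqr big1// => i _; rewrite mxE expr0n.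
Qed.

Lemma Gdistxx S : Gdist S S = 0.
Proof. by apply/Gtuple0; exists 1%g => l; rewrite perm1. Qed.

Lemma Gdist_positivity S T : Gdist S T = 0 -> S = T.
Proof.
move=> /Gtuple0[s sP]; apply: AQ_inj.
by rewrite !AQ_reprE (sum_dirac_perm sP).
Qed.

Lemma Gdist_sym S T : Gdist S T = Gdist T S.
Proof. exact: Gtuple_sym. Qed.

Lemma Gdist_triangle T S U : Gdist S U <= Gdist S T + Gdist T U.
Proof. exact: Gtuple_triangle. Qed.

HB.instance Definition _ := gen_eqMixin AQ.
HB.instance Definition _ := gen_choiceMixin AQ.
HB.instance Definition _ := @isMetric.Build R AQ Gdist
  Gdistxx Gdist_positivity Gdist_sym Gdist_triangle.

End Qpoints.

(* [Pi] stands for the projection of the bundle: only its fibers and the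
   topologies of the total space and of the base are involved *)
Section multisection.
Context (S E : topologicalType) (Pi : E -> S).

Definition fiber (p : S) : set E := Pi @^-1` [set p].

Definition msupp (M : E -> nat) (p : S) : set E :=
  fiber p `&` [set xi | (0 < M xi)%N].

(* the sum over an infinite support is 0 by convention, hence the explicit
   finiteness *)
Definition multisection (Q : nat) (M : E -> nat) :=
  forall p, finite_set (msupp M p) /\
    (\big[addn/0]_(xi \in fiber p) M xi)%N = Q.

(* The family is taken to separate the points of M_p, i.e. to cover M_p.  If
   a point of M_p could lie outside the union, on the boundary of a member,
   even the continuous 2-valued function q |-> [[0]] + [[1 - |q|]] on the line
   would fail the condition: take p = 0 and the single set {(q, v) | v < 1}. *)
Definition separating_family (M : E -> nat) (p : S) (VV : set (set E)) :=
  [/\ forall V, VV V -> open V,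
      trivIset VV id,
      forall V, VV V -> exists! xi, (msupp M p `&` V) xi &
      msupp M p `<=` \bigcup_(V in VV) V].

Definition coherent (M : E -> nat) :=
  forall p VV, separating_family M p VV ->
    exists2 U, open_nbhs p U &
      forall q V, U q -> VV V -> forall xi, (msupp M p `&` V) xi ->
        (\big[addn/0]_(zeta \in msupp M q `&` V) M zeta)%N = M xi.

End multisection.

Section associated_function.
Context (R : realType) (Q n : nat) (S : topologicalType).
Local Notation V := 'rV[R]_n.
Variable M : S * V -> nat.

Definition u_meas (p : S) : set V -> \bar R :=
  fun A => (\sum_(v \in [set: V]) (M (p, v))%:R%:E * diracV v A)%E.

Lemma u_meas_AQ (HM : multisection fst Q M) (p : S) :
  exists w : 'I_Q -> V, u_meas p = sum_dirac w.
Proof.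
have [fM sM] := HM p.
have inj : set_bij [set: V] (fiber fst p) (fun v : V => (p, v)).
  split=> [v _//|v w _ _ [->]//|[q v] /= qp].
  by exists v => //; rewrite -qp.
have fX : finite_set [set v | (0 < M (p, v))%N].
  apply: (sub_finite_set (B := snd @` msupp fst M p)); last exact: finite_image.
  by move=> v /= v0; exists (p, v).
pose X := fset_set [set v | (0 < M (p, v))%N].
have X0 v : v \notin X -> M (p, v) = 0%N.
  by rewrite /X in_fset_set// notin_setE/= => /negP; rewrite lt0n negbK => /eqP.
have sX : (\sum_(v <- X) M (p, v))%N = Q.
  by rewrite -sM (reindex_fsbig (fun v => (p, v)) [set: V] _ _ inj) (@fsbigTE _ _ _ _ X).
pose s := flatten [seq nseq (M (p, v)) v | v <- X].
have ss : size s == Q.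
  rewrite /s size_flatten /shape -map_comp sumnE big_map -sX; apply/eqP.
  by apply: eq_bigr => v _ /=; rewrite size_nseq.
exists (tnth (Tuple ss)); apply/funext => A.
rewrite /u_meas (@fsbigTE _ _ _ _ X); last by move=> v /X0 ->; rewrite mul0e.
rewrite /sum_dirac -(big_tuple _ _ (Tuple ss) xpredT (fun v => diracV v A))/=.
rewrite /s big_flatten/= big_map; apply: eq_bigr => v _.
rewrite big_nseq; elim: (M (p, v)) => [|k ih]; first by rewrite mul0e.
by rewrite iterS -ih /diracV /dirac -!EFinM -EFinD mulrSr mulrDl mul1r addrC.
Qed.

Definition u_of (HM : multisection fst Q M) (p : S) : AQ R Q n :=
  MkAQ (u_meas_AQ HM p).

End associated_function.

(* Main.v *)
Require Import Defs.
From mathcomp Require Import all_boot all_order all_algebra all_fingroup finmap.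
From mathcomp Require Import all_classical all_reals all_analysis.
Import numFieldNormedType.Exports.

Set Implicit Arguments.
Unset Strict Implicit.
Unset Printing Implicit Defensive.
Import Order.TTheory GRing.Theory Num.Theory.
Local Open Scope classical_set_scope.
Local Open Scope ring_scope.

(** Write u_M(p) as a sum of Q Dirac masses at points [sheets p l], l < Q.
Then M(p, v) is the number of l with [sheets p l = v], and the mass that M
puts above p in a set A is the number of l with (p, sheets p l) in A
([sum_M_sheets]).  Both properties thus become statements about Q-tuples of
points up to permutation: coherence compares numbers of points in open sets,
and smallness of the distance G means that some permutation moves each point
only a little ([Gtuple_lt_ball], [Gtuple_le_ball]).

If u_M is continuous, each point (p, sheets p l) has a product neighbourhood
inside the member of the separating family that contains it.  For q near p
there is a permutation s such that each sheets q (s l) is so close to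
sheets p l that (q, sheets q (s l)) lies in that same member; as the members
are disjoint, s matches the points above q in any member with the points above
p in it, and the masses agree.

If M is coherent, apply coherence to the family of cylinders over the balls of
a small radius r about the points of u_M(p), where r is so small that balls
about distinct points are disjoint.  For q near p every such ball contains as
many points of u_M(q) as its centre has multiplicity in u_M(p).  The
multiplicities add up to Q, so all the points of u_M(q) are accounted for, and
they can be matched with those of u_M(p) at distance less than r ([matching]).
Hence G(u_M(p), u_M(q)) is at most a constant times r. *)

(** * Matching finite families by counting *)

(** The inequality is asked for the values of [a] only: at any other value [a]
has no fibre.  Then the list of the values of [a] is, up to a permutation, a
subsequence of that of [c], and the two have the same length. *)
Lemma perm_of_count (T : eqType) (Q : nat) (a c : 'I_Q -> T) :
  (forall i, #|[pred l | a l == a i]| <= #|[pred l | c l == a i]|)%N ->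
  exists s : 'S_Q, forall l, a l = c (s l).
Proof.
move=> ac.
have cnt (u : 'I_Q -> T) x :
    count_mem x [tuple u i | i < Q] = #|[pred l | u l == x]|.
  by rewrite /= count_map -sum1_count -sum1_card big_enum_cond; apply: eq_bigl.
have /count_subseqP[t tc pt] :
    forall x, (count_mem x [tuple a i | i < Q]
               <= count_mem x [tuple c i | i < Q])%N.
  move=> x; rewrite !cnt; have [i /eqP <-//|/= none] := pickP [pred i | a i == x].
  by rewrite eq_card0// => i; exact: none.
have et : t = [tuple c i | i < Q].
  by apply/eqP; rewrite -(size_subseq_leqif tc) -(perm_size pt) !size_tuple.
move: pt; rewrite et => /tuple_permP[s e]; exists s => l.
have : [tuple a i | i < Q] = [tuple tnth [tuple c i | i < Q] (s i) | i < Q].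
  exact/val_inj.
by move=> /(congr1 (fun t => tnth t l)); rewrite !tnth_mktuple.
Qed.

(** Think of [B x] as a ball about [x].  Replacing each [b l] by the centre of
the ball that contains it turns the matching up to closeness into a matching up
to equality. *)
Lemma matching (T : eqType) (Q : nat) (B : T -> pred T) (a b : 'I_Q -> T) :
  (forall i, B (a i) (a i)) ->
  (forall i j x, B (a i) x -> B (a j) x -> a i = a j) ->
  (forall i, #|[pred l | a l == a i]| <= #|[pred l | B (a i) (b l)]|)%N ->
  exists s : 'S_Q, forall l, B (a l) (b (s l)).
Proof.
move=> Ba sepB cnt.
(* A point b l outside all the balls stays in place: it is then different from
   all the centres, since these lie in their own balls. *)
pose c l := odflt (b l) (omap a [pick k | B (a k) (b l)]).
have cE l i : (c l == a i) = B (a i) (b l).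
  rewrite /c; case: pickP => [k Bk|none] /=.
    by apply/eqP/idP => [<-//|Bi]; exact: sepB Bk Bi.
  by rewrite none; apply/eqP => bl; have := none i; rewrite bl Ba.
have [s sP] : exists s : 'S_Q, forall l, a l = c (s l).
  apply: perm_of_count => i; apply: leq_trans (cnt i) _.
  by apply: eq_leq; apply: eq_card => l; rewrite !inE cE.
by exists s => l; rewrite -cE sP.
Qed.

(** * The metric G in terms of balls for the sup norm *)

Section l2.
Context (R : realType) (I : finType).
Implicit Types f : I -> R.

Lemma le_l2norm f i : `|f i| <= l2norm f.
Proof.
rewrite -ler_sqr ?nnegrE ?l2norm_ge0// real_normK ?num_real// l2norm_sqr.
by rewrite (bigD1 i)//= lerDl sumr_ge0// => j _; exact: sqr_ge0.
Qed.

Lemma l2norm_le_card f (r : R) :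
  (forall i, `|f i| <= r) -> l2norm f <= #|I|%:R * r.
Proof.
move=> fr; have [i0 _|none] := pickP (@predT I); last first.
  rewrite /l2norm big1 ?sqrtr0; first by rewrite eq_card0 ?mul0r.
  by move=> i; have := none i.
have r0 : 0 <= r by apply: le_trans (fr i0).
rewrite -ler_sqr ?nnegrE ?l2norm_ge0 ?mulr_ge0// l2norm_sqr exprMn.
have I0 : (0 < #|I|)%N by apply/card_gt0P; exists i0.
apply: (@le_trans _ _ (\sum_(i : I) r ^+ 2)).
  by apply: ler_sum => i _; rewrite -(real_normK (num_real (f i))) ler_sqr ?nnegrE.
rewrite sumr_const -[leLHS]mulr_natl ler_wpM2r ?sqr_ge0//.
by rewrite -natrX ler_nat leq_pmulr.
Qed.

End l2.

Section Q_tuples.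
Context (R : realType) (Q n : nat).
Implicit Types v w : 'I_Q -> 'rV[R]_n.

Lemma ball_row (x y : 'rV[R]_n) (e : R) : 0 < e ->
  ball x e y <-> forall i, `|(x - y) 0 i| < e.
Proof.
move=> e0; split=> [[_ xy] i|xy].
  by have := xy 0 i; rewrite -ball_normE /= !mxE.
by split=> // i j; have := xy j; rewrite (ord1 i) -ball_normE /= !mxE.
Qed.

Lemma Gtuple_lt_ball v w (e : R) : Gtuple v w < e ->
  exists s : 'S_Q, forall l, ball (v l) e (w (s l)).
Proof.
have [s ->] := Gtuple_ex v w; rewrite Gcost_sqrt => lt_e; exists s => l.
apply/ball_row => [|i]; apply: le_lt_trans lt_e; first exact: l2norm_ge0.
exact: (le_l2norm (fun p : 'I_Q * 'I_n => (v p.1 - w (s p.1)) 0 p.2) (l, i)).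
Qed.

Lemma Gtuple_le_ball v w (s : 'S_Q) (r : R) :
  (forall l, ball (v l) r (w (s l))) -> Gtuple v w <= #|{: 'I_Q * 'I_n}|%:R * r.
Proof.
move=> vw; apply: (le_trans (Gtuple_le v w s)); rewrite Gcost_sqrt.
apply: l2norm_le_card => -[l i] /=; apply: ltW.
by have [r0 _] := vw l; have /(ball_row _ _ r0) := vw l; apply.
Qed.

Lemma near_separated v :
  \forall r \near (0 : R)^'+, forall i j x,
    ball (v i) r x -> ball (v j) r x -> v i = v j.
Proof.
apply: filter_forall => i; apply: filter_forall => j.
have [->|vij] := eqVneq (v i) (v j); first by near=> r.
have d0 : 0 < `|v i - v j| / 2 by rewrite divr_gt0// normr_gt0 subr_eq0.
near=> r => x vix vjx; exfalso.
have := ball_triangle vix (ball_sym vjx).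
rewrite -ball_normE /= ltNge => /negP; apply.
have rd : r <= `|v i - v j| / 2 by near: r; exact: nbhs_right_le.
by rewrite [leRHS]splitr lerD.
Unshelve. all: by end_near. Qed.

End Q_tuples.

(** * Multisections as families of sheets *)

Section multisections.
Context (R : realType) (Q n : nat) (S : topologicalType).
Local Notation V := 'rV[R]_n.
Variable M : S * V -> nat.
Hypothesis HM : multisection fst Q M.

(** Any enumeration of the points of u_M(p) with multiplicity; it is chosen for
each p separately, so [sheets^~ l] need not be continuous even if u_M is. *)
Definition sheets (p : S) : 'I_Q -> V := AQ_repr (u_of HM p).

Lemma M_sheets p v : M (p, v) = #|[pred l | sheets p l == v]|.
Proof.
have := congr1 (fun f => f [set v]) (AQ_reprE (u_of HM p)).
rewrite sum_dirac1 -/(sheets p) /= /u_meas.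
rewrite -(@fsbig_widen _ _ _ _ [set v])//=; last first.
  by move=> w [_ /= wv]; rewrite /diracV /dirac indicE memNset ?mule0//.
rewrite fsbig_set1 /diracV /dirac indicE mem_set// mule1 => -[/eqP].
by rewrite eqr_nat => /eqP.
Qed.

Lemma msupp_sheets p l : msupp fst M p (p, sheets p l).
Proof.
by split=> //=; rewrite M_sheets; apply/card_gt0P; exists l; rewrite inE.
Qed.

Lemma msuppP p xi : msupp fst M p xi -> exists l, xi = (p, sheets p l).
Proof.
case: xi => q v []; rewrite /fiber /= => -> /=; rewrite M_sheets => /card_gt0P[l].
by rewrite inE => /eqP <-; exists l.
Qed.

(** Counting the pairs (zeta, l) with zeta = (p, sheets p l) in A in two ways:
each zeta comes from M(zeta) indices l, each l from at most one zeta. *)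
Lemma sum_M_sheets p (A : set (S * V)) :
  (\big[addn/0]_(zeta \in msupp fst M p `&` A) M zeta)%N =
  #|[pred l | `[< A (p, sheets p l) >]]|.
Proof.
have fin : finite_set (msupp fst M p `&` A) by apply: finite_setIl; case: (HM p).
rewrite fsbig_finite// -sum1_card.
set X := fset_set _.
have inX z : (z \in X) = `[< (msupp fst M p `&` A) z >].
  by rewrite in_fset_set//; apply/idP/asboolP; rewrite inE.
rewrite (eq_big_seq (fun z => \sum_(l < Q) (z == (p, sheets p l)))%N); last first.
  move=> [q v]; rewrite inX => /asboolP[[+ _] _]; rewrite /fiber /= => ->.
  rewrite M_sheets -sum1_card big_mkcond /=; apply: eq_bigr => l _.
  by rewrite inE xpair_eqE eqxx eq_sym; case: eqP.
rewrite exchange_big [RHS]big_mkcond /=; apply: eq_bigr => l _.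
transitivity (count_mem (p, sheets p l) (enum_fset X)).
  by rewrite -sum1_count [RHS]big_mkcond; apply: eq_bigr => z _ /=; case: eqP.
rewrite count_uniq_mem ?fset_uniq// [_ \in _]inX inE.
rewrite (_ : `[< _ >] = `[< A (p, sheets p l) >]); first by case: asboolP.
by apply/asboolP/asboolP => [[]//|Al]; split=> //; exact: msupp_sheets.
Qed.

(** * Coherence and continuity *)

Lemma coherent_continuous : coherent fst M -> continuous (u_of HM).
Proof.
move=> coh p; apply/cvg_ballP => e e0.
pose N : R := #|{: 'I_Q * 'I_n}|%:R.
have [r [r0 sep Nr]] : exists r : R, [/\ 0 < r,
    forall i j x, ball (sheets p i) r x -> ball (sheets p j) r x ->
      sheets p i = sheets p j & N * r < e].
  near (0 : R)^'+ => r; exists r; have r0 : 0 < r by [].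
  split=> //; first by near: r; exact: near_separated.
  (* N itself is zero if n = 0 *)
  have : r < e / (N + 1).
    by near: r; apply: nbhs_right_lt; rewrite divr_gt0// ltr_wpDl.
  rewrite ltr_pdivlMr ?ltr_wpDl// => /(lt_trans _); apply.
  by rewrite mulrC ltr_pM2l// ltrDl.
pose VV := [set W : set (S * V) |
  exists i, W = [set z | ball (sheets p i) r z.2]].
have /coh[U oU UP] : separating_family fst M p VV.
  split.
  - move=> _ [i ->]; apply: (@open_comp _ _ snd); last exact: ball_open.
    by move=> z _; exact: cvg_snd.
  - by move=> _ _ [i ->] [j ->] [z [/= zi zj]]; rewrite (sep _ _ _ zi zj).
  - move=> _ [i ->]; exists (p, sheets p i); split.
      by split; [exact: msupp_sheets|exact: ballxx].
    move=> _ [/msuppP[l ->] /= il]; congr pair.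
    exact: sep il (ballxx _ r0).
  - move=> _ /msuppP[l ->]; exists [set z | ball (sheets p l) r z.2].
      by exists l.
    exact: ballxx.
apply: filterS (open_nbhs_nbhs oU) => q Uq.
have [s sP] : exists s : 'S_Q,
    forall l, `[< ball (sheets p l) r (sheets q (s l)) >].
  apply: (@matching _ _ (fun x y => `[< ball x r y >])).
  - by move=> i; apply/asboolP; exact: ballxx.
  - by move=> i j x /asboolP xi /asboolP xj; exact: sep xi xj.
  - move=> i; rewrite -M_sheets.
    rewrite -(UP q [set z | ball (sheets p i) r z.2] Uq) ?sum_M_sheets//.
      by exists i.
    by split; [exact: msupp_sheets|exact: ballxx].
rewrite ballEmdist /=; apply: le_lt_trans Nr.
by apply: (@Gtuple_le_ball _ _ _ _ _ s) => l; have /asboolP := sP l.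
Unshelve. all: by end_near. Qed.

Lemma continuous_coherent : continuous (u_of HM) -> coherent fst M.
Proof.
move=> ctn p VV [opn triv uniq cov].
have /choice[F FP] : forall l, exists V : set (S * V), VV V /\ V (p, sheets p l).
  by move=> l; have [V VVV Vl] := cov _ (msupp_sheets p l); exists V.
(* A radius that works for all q near p at once; as there are finitely many
   sheets, one radius then serves them all. *)
have tube l : \forall r \near (0 : R)^'+, \forall q \near p,
    forall y, ball (sheets p l) r y -> F l (q, y).
  have [VF Fl] := FP l.
  have [[A B] /= [nA /nbhs_ballP[d /= d0 dB]] AB] : nbhs (p, sheets p l) (F l).
    by apply: open_nbhs_nbhs; split=> //; exact: opn.
  near=> r; apply: filterS nA => q Aq y ly; apply: AB; split=> //=.
  by apply: dB; apply: le_ball ly; near: r; exact: nbhs_right_le.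
have [r [r0 rP]] : exists r : R, 0 < r /\ forall l, \forall q \near p,
    forall y, ball (sheets p l) r y -> F l (q, y).
  near (0 : R)^'+ => r; exists r; split; first by [].
  by near: r; exact: filter_forall.
have /filter_forall tubeP := rP.
have : nbhs p [set q | (forall l y, ball (sheets p l) r y -> F l (q, y)) /\
    ball (u_of HM p) r (u_of HM q)].
  by apply: filterI; [exact: tubeP|have /cvg_ballP := ctn p; apply].
rewrite nbhsE => -[U oU UP]; exists U => // q V Uq VVV _ [/msuppP[k ->] Vk].
have [tq] := UP q Uq; rewrite ballEmdist /= => /Gtuple_lt_ball[s sP].
(* Compare the two counts index by index along the permutation s. *)
rewrite sum_M_sheets M_sheets -!sum1_card (reindex_inj (@perm_inj _ s)).
apply: eq_bigl => l; rewrite !inE.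
have [VF Fl] := FP l; have Fq := tq l _ (sP l).
apply/asboolP/eqP => [Vq|lk].
  have VE : V = F l by apply: triv => //; exists (q, sheets q (s l)).
  have [xi [_ xi1]] := uniq V VVV.
  have xil : xi = (p, sheets p l).
    by apply: xi1; split; [exact: msupp_sheets|rewrite VE].
  have : xi = (p, sheets p k) by apply: xi1; split => //; exact: msupp_sheets.
  by rewrite xil => -[].
suff -> : V = F l by [].
by apply: triv => //; exists (p, sheets p l); split=> //; rewrite lk.
Unshelve. all: by end_near. Qed.

End multisections.

Theorem proposition3p5 (R : realType) (m n Q : nat) (hQ : (1 <= Q)%N)
    (Sigma : riemannianC1 R m) (M : Sigma * 'rV[R]_n -> nat)
    (HM : multisection fst Q M) :
  coherent fst M <-> continuous (u_of HM).
Proof. by split; [exact: coherent_continuous|exact: continuous_coherent]. Qed.
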